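(* Let $G=(V,E)$ be a connected graph with $|V|\le5$, let $Q\in\mathbb{R}^V$, and set $H_Q=\Delta_G+Q$. If $H_Q$ has simple eigenvalues and satisfies Condition (I), then it also satisfies Condition (S).
   Context: $G=(V,E)$ is a finite simple undirected graph. Its combinatorial Laplacian is $\Delta_G u(j)=\sum_{k\sim j}(u(j)-u(k))$. A potential $Q\in\mathbb{R}^V$ is identified with the diagonal operator $(Qu)(j)=Q(j)u(j)$. Let $(\phi_k)_{k=1}^n$, $n=|V|$, be a real orthonormal basis of eigenvectors of $H_Q$. Condition (I): the matrix $(\phi_k(j)^2)_{j,k}$ is invertible. Condition (S): for every pair $k\neq\ell$ there is $j\in V$ with $\phi_k(j)\phi_\ell(j)\neq0$. *)

(* Defs.v *)
From HB Require Import structures.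
From mathcomp Require Import all_boot all_order all_algebra.
From mathcomp Require Import reals.

Set Implicit Arguments.
Unset Strict Implicit.
Unset Printing Implicit Defensive.

Import Order.TTheory GRing.Theory Num.Theory.
Import passmx.
Local Open Scope ring_scope.

(* Real functions on the vertex set; R^o (R as a vector space over itself)
   gives access to the vectType structure of finite functions. *)
Notation "''Fun' ( V , R )" := {ffun V -> R^o}
  (at level 8, format "''Fun' ( V ,  R )").

Definition graph_connected (V : finType) (e : rel V) : Prop :=
  forall x y : V, connect e x y.

Section Operators.
Variables (R : realType) (V : finType).

Definition laplacian_fun (e : rel V) (u : 'Fun(V, R)) : 'Fun(V, R) :=
  [ffun j => \sum_(k | e j k) (u j - u k)].

Definition potential_fun (Q u : 'Fun(V, R)) : 'Fun(V, R) :=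
  [ffun j => Q j * u j].

(* These linearity facts make linfun agree with the functions above. *)
Fact laplacian_fun_linear e : linear (laplacian_fun e).
Proof.
move=> a u v; apply/ffunP=> j; rewrite !ffunE scaler_sumr -big_split /=.
by apply: eq_bigr => k _; rewrite !ffunE scalerBr opprD addrACA.
Qed.

HB.instance Definition _ (e : rel V) :=
  GRing.isLinear.Build R 'Fun(V, R) 'Fun(V, R) _ (laplacian_fun e)
    (laplacian_fun_linear e).

Fact potential_fun_linear Q : linear (potential_fun Q).
Proof.
by move=> a u v; apply/ffunP=> j; rewrite !ffunE mulrDr -scalerAr.
Qed.

HB.instance Definition _ (Q : 'Fun(V, R)) :=
  GRing.isLinear.Build R 'Fun(V, R) 'Fun(V, R) _ (potential_fun Q)
    (potential_fun_linear Q).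

Definition laplacian (e : rel V) : 'End('Fun(V, R)) :=
  linfun (laplacian_fun e).

Definition potential (Q : 'Fun(V, R)) : 'End('Fun(V, R)) :=
  linfun (potential_fun Q).

Definition schroedinger (e : rel V) (Q : 'Fun(V, R)) : 'End('Fun(V, R)) :=
  laplacian e + potential Q.

Fact schroedingerE e Q (u : 'Fun(V, R)) j :
  schroedinger e Q u j = \sum_(k | e j k) (u j - u k) + Q j * u j.
Proof. by rewrite add_lfunE !lfunE /= !ffunE. Qed.

(* For the symmetric operators considered here, geometric and algebraic
   multiplicities coincide. *)
Definition simple_eigenvalues (H : 'End('Fun(V, R))) : Prop :=
  forall a : R, leigenvalue H a -> \dim (leigenspace H a) = 1%N.

Definition dotf (u v : 'Fun(V, R)) : R := \sum_j u j * v j.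

Definition orthonormal_eigenbasis (H : 'End('Fun(V, R)))
    (phi : #|V|.-tuple 'Fun(V, R)) : Prop :=
  [/\ basis_of fullv phi,
      forall k l, dotf (tnth phi k) (tnth phi l) = (k == l)%:R
    & forall k, exists a : R, H (tnth phi k) = a *: tnth phi k].

(* Vertices are numbered by enum_val so as to index the rows. *)
Definition conditionI (phi : #|V|.-tuple 'Fun(V, R)) : Prop :=
  \matrix_(j < #|V|, k < #|V|) (tnth phi k (enum_val j) : R) ^+ 2 \in unitmx.

Definition conditionS (phi : #|V|.-tuple 'Fun(V, R)) : Prop :=
  forall k l : 'I_#|V|, k != l ->
    exists j : V, tnth phi k j * tnth phi l j != 0.

End Operators.

(* Main.v *)
Require Import Defs.
From mathcomp Require Import all_boot all_order all_algebra.
From mathcomp Require Import reals.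

Import Order.TTheory GRing.Theory Num.Theory.
Local Open Scope ring_scope.

(** On at most five vertices, two eigenvectors with disjoint supports include
    one, [u], whose support has at most two vertices.  By connectedness some
    vertex outside the support of [u] is adjacent to it, and the eigenvalue
    equation there says that the values of [u] on its neighbours sum to zero;
    hence [u] is supported on exactly two vertices [x], [y], with
    [u x = - u y].  Every eigenvector orthogonal to [u] takes equal values at
    [x] and [y], so the rows [x] and [y] of the matrix of squares coincide. *)

Lemma connect_crossing_edge {T : finType} {e : rel T} (A : {set T}) {x y : T} :
  connect e x y -> x \notin A -> y \in A ->
  exists i j, [/\ e i j, i \notin A & j \in A].
Proof.
case/connectP=> p; elim: p x => [|z p IH] x /=.
  by move=> _ -> /negPf->.
case/andP=> exz pz yE xA yA; have [zA|zA] := boolP (z \in A).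
  by exists x, z.
exact: IH pz yE zA yA.
Qed.

Lemma eigenfunction_small_support {R : realType} {V : finType} {e : rel V}
    {Q u : 'Fun(V, R)} {a : R} :
  graph_connected e -> schroedinger e Q u = a *: u ->
  (#|[set j | (u j != 0)%R]| <= 2)%N ->
  (exists j, u j != 0) -> (exists j, u j = 0) ->
  exists x y, [/\ x != y, u x != 0, u y = - u x
                & forall z, z != x -> z != y -> u z = 0].
Proof.
move=> e_conn Hu cardA [y0 uy0] [x0 ux0].
have x0A : x0 \notin [set j | u j != 0] by rewrite inE ux0 eqxx.
have y0A : y0 \in [set j | u j != 0] by rewrite inE.
have [j [x [ejx]]] := connect_crossing_edge _ (e_conn x0 y0) x0A y0A.
rewrite !inE negbK => /eqP uj ux.
(* Since [u j = 0], the potential term and the right-hand side both vanish at [j]. *)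
have sum0 : \sum_(k | e j k) (u k : R) = 0.
  have := congr1 (fun f : 'Fun(V, R) => f j) Hu.
  rewrite schroedingerE ffunE uj mulr0 addr0 scaler0.
  under eq_bigr do rewrite sub0r.
  by rewrite sumrN => /eqP; rewrite oppr_eq0 => /eqP.
(* The nonzero term [u x] must be cancelled in [sum0], so [j] has a second neighbour [y] in the
   support; otherwise the sum would collapse to [u x]. *)
have [y /and3P[ejy yx uy]|noy] :=
    pickP [pred y | [&& e j y, y != x & u y != 0]]; last first.
  case/eqP: ux; rewrite -[RHS]sum0 (bigD1 x) //= big1 ?addr0 // => k /andP[ejk kx].
  by apply/eqP; move: (noy k); rewrite /= ejk kx => /negbT; rewrite negbK.
have xy : x != y by rewrite eq_sym.
have AE : [set x; y] = [set j | u j != 0].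
  apply/eqP; rewrite eqEcard cards2 xy cardA andbT.
  by apply/subsetP=> k; rewrite !inE => /orP[] /eqP->.
have u0 z : z != x -> z != y -> u z = 0.
  move=> zx zy; have := in_set2 z x y; rewrite AE inE (negPf zx) (negPf zy).
  by move/negbFE/eqP.
exists x, y; split=> //; apply/eqP; rewrite -addr_eq0 addrC; apply/eqP.
rewrite -[RHS]sum0 (bigD1 x) //= (bigD1 y) ?ejy //= big1 ?addr0 //.
by move=> k /andP[/andP[_ kx] ky]; apply: u0.
Qed.

Lemma antisymmetric_pair_not_conditionI {R : realType} {V : finType}
    {phi : #|V|.-tuple 'Fun(V, R)} {k : 'I_#|V|} {x y : V} :
  (forall l, l != k -> dotf (tnth phi k) (tnth phi l) = 0) ->
  x != y -> tnth phi k x != 0 -> tnth phi k y = - tnth phi k x ->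
  (forall z, z != x -> z != y -> tnth phi k z = 0) -> ~ conditionI phi.
Proof.
move=> orth xy ux uy u0; rewrite /conditionI unitmxE.
rewrite (@determinant_alternate _ _ _ (enum_rank x) (enum_rank y)) ?unitr0 //.
  by rewrite (inj_eq enum_rank_inj).
move=> l; rewrite !mxE !enum_rankK.
(* In column [k] the opposite signs disappear on squaring. In any other column, orthogonality
   reduces to [u x * (v x - v y) = 0], with [u] and [v] the eigenvectors of indices [k] and [l]. *)
have [->|lk] := eqVneq l k; first by rewrite uy sqrrN.
have := orth l lk; rewrite /dotf (bigD1 x) //= (bigD1 y) 1?eq_sym //=.
rewrite big1 ?addr0; last by move=> z /andP[zx zy]; rewrite u0 ?mul0r.
rewrite uy mulNr -mulrBr => /eqP; rewrite mulf_eq0 (negPf ux) subr_eq0.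
by move=> /eqP->.
Qed.

Theorem proposition4p3 (R : realType) (V : finType) (e : rel V)
    (e_sym : symmetric e) (e_irr : irreflexive e)
    (e_conn : graph_connected e) (V_le5 : (#|V| <= 5)%N)
    (Q : 'Fun(V, R)) (phi : #|V|.-tuple 'Fun(V, R))
    (phi_basis : orthonormal_eigenbasis (schroedinger e Q) phi) :
  simple_eigenvalues (schroedinger e Q) -> conditionI phi -> conditionS phi.
Proof.
case: phi_basis => _ orth eig _ condI k l kl.
pose supp m := [set j | tnth phi m j != 0].
have supp_ex m : exists j, tnth phi m j != 0.
  apply/existsP; apply: contraT; rewrite negb_exists => /forallP phi0.
  have := orth m m; rewrite eqxx /dotf big1 => [/eqP|j _].
    by rewrite eq_sym oner_eq0.
  by have := phi0 j; rewrite negbK => /eqP->; rewrite mul0r.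
apply/existsP; apply: contraT; rewrite negb_exists => /forallP prod0.
have disj j : (tnth phi k j == 0) || (tnth phi l j == 0).
  by have := prod0 j; rewrite negbK mulf_eq0.
have small m : (#|supp m| <= 2)%N -> (exists j, tnth phi m j = 0) -> False.
  move=> card_m zero_m; have [a Ha] := eig m.
  have [x [y [xy ux uy u0]]] :=
    eigenfunction_small_support e_conn Ha card_m (supp_ex m) zero_m.
  apply: antisymmetric_pair_not_conditionI xy ux uy u0 condI => i im.
  by rewrite orth eq_sym (negPf im).
have card_kl : (#|supp k| + #|supp l| <= 5)%N.
  rewrite -cardsUI (_ : supp k :&: supp l = set0) ?cards0 ?addn0.
    exact: leq_trans (max_card _) V_le5.
  by apply/setP=> j; rewrite !inE -negb_or disj.
have [k2|k3] := leqP #|supp k| 2.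
  (* By disjointness, a point where one eigenvector is nonzero is a zero of the other, as [small]
     demands. *)
  case: (small k k2); have [j lj] := supp_ex l; exists j; apply/eqP.
  by have := disj j; rewrite (negPf lj) orbF.
case: (small l).
  (* As [supp k] has at least 3 elements, [3 + #|supp l|] is at most [5 = 3 + 2]. *)
  by rewrite -(leq_add2l 3); apply: leq_trans card_kl; rewrite leq_add2r.
have [j kj] := supp_ex k; exists j; apply/eqP.
by have := disj j; rewrite (negPf kj).
Qed.
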